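(* Let $q>1$ and consider $N^{(n)}_k$ under the measure $\mathcal{P}_n^{(q)}$. For $k\in\mathbb{N}$ let $\{Z_{j;k}\}_{j=k}^\infty$ be independent random variables such that $Z_{j;k}$ has the Bernoulli distribution with parameter $\frac{(q-1)q^{k-1}}{q^j-1}$, and let $\{Y_i\}_{i=0}^\infty$ be independent random variables such that $Y_i$ has the Bernoulli distribution with parameter $\frac{q-1}{q^{i+1}}$. As $n\to\infty$: (i) For $k\in\mathbb{N}$ fixed, $N^{(n)}_k$ converges in distribution to the distribution of $\sum_{j=k}^\infty Z_{j;k}$. This distribution is supported on $\mathbb{Z}^+$; (ii) For integers $k_n\in[n]$ satisfying $\lim_{n\to\infty}k_n=\infty$ and $\lim_{n\to\infty}(n-k_n)=\infty$, $N^{(n)}_{k_n}$ converges in distribution to the distribution of $\sum_{i=0}^\infty Y_i$. This distribution is supported on $\mathbb{Z}^+$; (iii) For $k\in\{0,1,2,\ldots\}$ fixed, $N^{(n)}_{n-k}$ converges in distribution to the distribution of $\sum_{i=0}^kY_i$. This distribution is supported on $\{0,1,\ldots,k+1\}$; (iv) $\sum_{i=0}^\infty Y_i\stackrel{\text{dist}}{=}\lim_{k\to\infty}\sum_{i=0}^kY_i\stackrel{\text{dist}}{=}\lim_{k\to\infty}\sum_{j=k}^\infty Z_{j;k}$. Thus, $$\lim_{k\to\infty}\lim_{n\to\infty}N^{(n)}_{n-k}\stackrel{\text{dist}}{=}\lim_{k\to\infty}\lim_{n\to\infty}N^{(n)}_k\stackrel{\text{dist}}{=}\sum_{i=0}^\infty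 Y_i,$$ where all limits are in the sense of convergence in distribution.
   Context: Write $[n]=\{1,\ldots,n\}$ and let $S_n$ be the set of permutations of $[n]$, written in one-line notation $\sigma=\sigma_1\cdots\sigma_n$; $\sigma^{-1}_k$ is the position of $k$ in $\sigma$. A parking function of length $n$ is a sequence $\pi=(\pi_1,\ldots,\pi_n)\in[n]^n$ with $|\{i:\pi_i\le j\}|\ge j$ for all $j\in[n]$; $PF_n$ is the set of these. The inversion statistic is $I_n(\sigma)=\sum_{1\le i<j\le n}1_{\sigma_j<\sigma_i}$. For $j\in[n]$ let $I_{n,<j}(\sigma)=\sum_{1\le i<j}1_{\sigma^{-1}_j<\sigma^{-1}_i}$ (the number of inversions of $\sigma$ involving $j$ and a number less than $j$) and $\tilde I_{n,<j}=I_{n,<j}+1$. For $q\in(0,\infty)$, the Mallows measure on $S_n$ is $P_n^{(q)}(\sigma)=q^{I_n(\sigma)}/K_n$, where $K_n=\sum_{\rho\in S_n}q^{I_n(\rho)}$ is the normalizing constant; $P_n$ denotes the uniform measure on $S_n$. The map $(\sigma,\tau)\mapsto(\tilde I_{n,<\tau_1}(\sigma),\ldots,\tilde I_{n,<\tau_n}(\sigma))$ sends $S_n\times S_n$ into $PF_n$, and $\mathcal{P}_n^{(q)}$ denotes the probability measure on $PF_n$ that is the image of $P_n^{(q)}\times P_n$ under this map. For $\pi\in PF_n$ and $k\in[n]$, $N^{(n)}_k(\pi)=|\{i\in[n]:\pi_i=k\}|$ is the number of times $k$ appears as an entry of $\pi$. $\mathbb{N}=\{1,2,\ldots\}$; $\mathbb{Z}^+=\{0,1,2,\ldots\}$,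 and ''supported on $A$'' means that the distribution gives total mass $1$ to the set $A$ (in particular the infinite sums are almost surely finite). $\stackrel{\text{dist}}{=}$ denotes equality of distributions. *)

(* Defs.v *)
From HB Require Import structures.
From mathcomp Require Import all_boot all_order all_algebra all_fingroup.
From mathcomp Require Import finmap.
From mathcomp Require Import all_classical all_reals all_analysis measurable_realfun.

Set Implicit Arguments.
Unset Strict Implicit.
Unset Printing Implicit Defensive.

Import Order.TTheory GRing.Theory Num.Theory.
Import numFieldNormedType.Exports.

Local Open Scope classical_set_scope.
Local Open Scope ring_scope.

(* Everything is indexed from 0: the element i of 'I_n stands for the element
   i + 1 of {1, ..., n}, both as a position and as a value. *)

Section permutation_statistics.
Variable n : nat.
Implicit Types (s t : 'S_n) (j : 'I_n).

Definition inversions s : nat :=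
  (\sum_(i < n) \sum_(j < n | i < j) (s j < s i))%N.

(* Here s^-1 j is the position of the value j in s. *)
Definition inversions_below s j : nat :=
  (\sum_(i < n | i < j) ((s^-1)%g j < (s^-1)%g i))%N.

Lemma inversions_below_le s j : (inversions_below s j <= j)%N.
Proof.
apply: (@leq_trans (\sum_(i < n | i < j) 1)%N).
  by apply: leq_sum => i _; case: (_ < _)%N.
rewrite sum1_card -[leqRHS]card_ord.
have jn := ltnW (ltn_ord j).
apply: (@leq_trans #|[set widen_ord jn i | i : 'I_j]%SET|); last first.
  exact: leq_imset_card.
apply/subset_leq_card/fintype.subsetP => i ij; apply/imsetP.
by exists (Ordinal ij) => //; exact: val_inj.
Qed.

Lemma inversions_below_lt s j : (inversions_below s j < n)%N.
Proof. exact: leq_ltn_trans (inversions_below_le s j) (ltn_ord j). Qed.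

(* The usual condition reads |{i : pi_i <= j}| >= j for 1-based values. *)
Definition is_parking (a : {ffun 'I_n -> 'I_n}) : bool :=
  [forall j : 'I_n, (j.+1 <= #|[set i | (a i <= j)%N]%SET|)%N].

(* A parking function (pi_1, ..., pi_n) is stored as
   i |-> pi_(i + 1) - 1 in {0, ..., n - 1}. *)
Record parking_function := ParkingFunction {
  parking_entries :> {ffun 'I_n -> 'I_n};
  _ : is_parking parking_entries }.

HB.instance Definition _ := [isSub for parking_entries].
HB.instance Definition _ := [Finite of parking_function by <:].

(* The 1-based values inversions_below s j + 1 are shifted down by one. *)
Definition park_entries (st : 'S_n * 'S_n) : {ffun 'I_n -> 'I_n} :=
  [ffun i => Ordinal (inversions_below_lt st.1 (st.2 i))].

Lemma park_entries_parking st : is_parking (park_entries st).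
Proof.
apply/forallP => j.
have jn : (j.+1 <= n)%N by [].
rewrite -[leqLHS]card_ord.
rewrite -(@card_imset _ _ (fun i : 'I_j.+1 => (st.2^-1)%g (widen_ord jn i))).
  apply/subset_leq_card/fintype.subsetP => _ /imsetP[i _ ->].
  rewrite !inE ffunE permKV /=.
  by apply: leq_trans (inversions_below_le _ _) _; rewrite /= -ltnS.
by move=> i k /perm_inj/(congr1 val)/= ik; exact: val_inj.
Qed.

Definition park (st : 'S_n * 'S_n) : parking_function :=
  ParkingFunction (park_entries_parking st).

End permutation_statistics.

(* Unlike the entries of a, the value k is 1-based. *)
Definition occurrences (R : realType) n (k : nat) (a : parking_function n) : R :=
  #|[set i | (a i).+1 == k]%SET|%:R.

HB.instance Definition _ (T : finType) :=
  isPointed.Build (perm_type T) (perm_one T).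
HB.instance Definition _ (T : finType) :=
  @isMeasurable.Build default_measure_display (perm_type T)
    discrete_measurable discrete_measurable0
    discrete_measurableC discrete_measurableU.

HB.instance Definition _ n :=
  isPointed.Build (parking_function n) (park (perm_one 'I_n, perm_one 'I_n)).
HB.instance Definition _ n :=
  @isMeasurable.Build default_measure_display (parking_function n)
    discrete_measurable discrete_measurable0
    discrete_measurableC discrete_measurableU.

Section measures_on_permutations.
Context {R : realType} {n : nat}.
Implicit Types w : 'S_n -> {posnum R}.

Definition weighted w : set 'S_n -> \bar R :=
  fun A => (\sum_(s \in A) ((w s)%:num / \sum_(r : 'S_n) (w r)%:num)%:E)%E.

Section weighted_probability.
Variable w : 'S_n -> {posnum R}.

Let mass (s : 'S_n) : \bar R := ((w s)%:num / \sum_(r : 'S_n) (w r)%:num)%:E.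

Let mass_ge0 s : (0 <= mass s)%E.
Proof. by rewrite lee_fin divr_ge0// sumr_ge0. Qed.

Let weightedE A : weighted w A = (\esum_(s in A) mass s)%E.
Proof. by rewrite esum_fset//; exact: finite_finset. Qed.

Let weighted0 : weighted w set0 = 0%E.
Proof. by rewrite weightedE esum_set0. Qed.

Let weighted_ge0 A : (0 <= weighted w A)%E.
Proof. by rewrite weightedE esum_ge0. Qed.

Let weighted_sigma_additive : semi_sigma_additive (weighted w).
Proof.
move=> F mF tF mUF; apply: cvg_toP.
  apply: ereal_nondecreasing_is_cvgn => a b ab.
  by apply: lee_sum_nneg_natr.
rewrite weightedE nneseries_sum_bigcup//.
by apply: eq_eseriesr => k _; rewrite weightedE.
Qed.

HB.instance Definition _ := isMeasure.Build _ _ _ (weighted w)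
  weighted0 weighted_ge0 weighted_sigma_additive.

Let weighted_setT : weighted w [set: _] = 1%E.
Proof.
rewrite /weighted (fsbigE (enum 'S_n)) ?enum_uniq//; last first.
  by move=> s _; rewrite mem_enum.
under eq_bigl do rewrite in_setT.
rewrite big_enum/= sumEFin -mulr_suml divff//.
rewrite gt_eqF// (bigD1 (perm_one _))//= ltr_pwDl// sumr_ge0//.
Qed.

HB.instance Definition _ :=
  Measure_isProbability.Build _ _ _ (weighted w) weighted_setT.

End weighted_probability.

Definition mallows (q : {posnum R}) : probability 'S_n R :=
  weighted (fun s => (q%:num ^+ inversions s)%:pos).

Definition uniform_perm : probability 'S_n R := weighted (fun=> 1%:pos).

End measures_on_permutations.
Arguments mallows {R} n q.
Arguments uniform_perm {R} n.

Section parking_measure.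
Context {R : realType}.
Variable n : nat.

Let measurable_park : measurable_fun [set: 'S_n * 'S_n] (@park n).
Proof.
move=> _ A _; rewrite setTI.
have -> : @park n @^-1` A = \bigcup_(x in @park n @^-1` A) [set x].
  by rewrite bigcup_imset1 image_id.
apply: fin_bigcup_measurable; first exact: finite_finset.
move=> [s t] _; rewrite (_ : [set (s, t)] = [set s] `*` [set t]).
  exact: measurableX.
by apply/seteqP; split=> [_ ->//|[s' t']/= [-> ->]].
Qed.

HB.instance Definition _ :=
  isMeasurableFun.Build _ _ _ _ (@park n) measurable_park.

Definition parking_prob (q : {posnum R}) :
    probability (parking_function n) R :=
  distribution (mallows n q \x uniform_perm n)%E
    (@park n : {mfun ('S_n * 'S_n)%type >-> parking_function n}).

Let measurable_occurrences k :
  measurable_fun [set: parking_function n] (@occurrences R n k).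
Proof. by []. Qed.

HB.instance Definition _ k :=
  isMeasurableFun.Build _ _ _ _ (@occurrences R n k)
    (measurable_occurrences k).

Definition occurrences_law (q : {posnum R}) (k : nat) : probability R R :=
  distribution (parking_prob q)
    (@occurrences R n k : {mfun parking_function n >-> R}).

End parking_measure.

Definition cvg_in_distribution (R : realType)
    (mu_ : nat -> probability R R) (mu : probability R R) : Prop :=
  forall f : R -> R, continuous f -> bounded_fun f ->
    (\int[mu_ n]_x (f x)%:E)%E @[n --> \oo] --> (\int[mu]_x (f x)%:E)%E.

Section families_of_random_variables.
Context {R : realType} {d} {T : measurableType d} (P : probability T R).

Definition independent_RVs d' (T' : measurableType d') (I : choiceType)
    (D : set I) (X : I -> {RV P >-> T'}) : Prop :=
  forall J : {fset I}, [set` J] `<=` D ->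
  forall A : I -> set T', (forall i, measurable (A i)) ->
    P (\bigcap_(i in [set` J]) (X i @^-1` A i)) =
    (\prod_(i <- J) P (X i @^-1` A i))%E.

Variable X : nat -> {RV P >-> bool}.

(* Bernoulli variables are bool-valued, and true counts as 1 in sums. *)
Definition partial_sum (m n : nat) (x : T) : R :=
  \sum_(m <= i < n) (X i x)%:R.

Definition infinite_sum (m : nat) (x : T) : \bar R :=
  (\sum_(m <= i <oo) ((X i x)%:R)%:E)%E.

Definition real_infinite_sum (m : nat) (x : T) : R :=
  fine (infinite_sum m x).

Let measurable_term i : measurable_fun setT (fun x => (X i x)%:R : R).
Proof.
exact: (@measurableT_comp _ _ _ _ _ _ (fun b : bool => b%:R : R) _ (X i)).
Qed.

Let measurable_partial_sum m n : measurable_fun setT (partial_sum m n).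
Proof. exact: measurable_sum. Qed.

Let measurable_infinite_sum m : measurable_fun setT (infinite_sum m).
Proof.
rewrite (_ : infinite_sum m = fun x =>
    (\sum_(i <oo | i \in [pred i | (m <= i)%N]) ((X i x)%:R)%:E)%E).
  apply: ge0_emeasurable_sum => [i x _ _|i _]; first by rewrite lee_fin ler0n.
  exact/measurable_EFinP.
by apply/funext => x; rewrite /infinite_sum eseries_cond.
Qed.

Let measurable_real_infinite_sum m : measurable_fun setT (real_infinite_sum m).
Proof. exact: measurableT_comp. Qed.

HB.instance Definition _ m n :=
  isMeasurableFun.Build _ _ _ _ (partial_sum m n)
    (measurable_partial_sum m n).
HB.instance Definition _ m :=
  isMeasurableFun.Build _ _ _ _ (infinite_sum m)
    (measurable_infinite_sum m).
HB.instance Definition _ m :=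
  isMeasurableFun.Build _ _ _ _ (real_infinite_sum m)
    (measurable_real_infinite_sum m).

Definition partial_sum_law (m n : nat) : probability R R :=
  distribution P (partial_sum m n : {mfun T >-> R}).

(* Only used for sums that are almost surely finite, the value fine +oo = 0
   being then irrelevant. *)
Definition infinite_sum_law (m : nat) : probability R R :=
  distribution P (real_infinite_sum m : {mfun T >-> R}).

End families_of_random_variables.

(* Main.v *)
Require Import Defs.
From HB Require Import structures.
From mathcomp Require Import all_boot all_order all_algebra all_fingroup.
From mathcomp Require Import finmap.
From mathcomp Require Import all_classical all_reals all_analysis measurable_realfun.
From mathcomp Require Import ring.

Set Implicit Arguments.
Unset Strict Implicit.
Unset Printing Implicit Defensive.

Import Order.TTheory GRing.Theory Num.Theory.
Import numFieldNormedType.Exports.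

Local Open Scope classical_set_scope.
Local Open Scope ring_scope.

(* Under the Mallows measure the numbers inversions_below s j are independent
   truncated geometric variables, because s |-> (inversions_below s j)_j is a
   bijection onto the sequences c with c j <= j and inversions s is the sum of
   the c j. Hence N_k has the law of Z_{k;k} + ... + Z_{n;k}, a sum of n - k + 1
   independent Bernoulli variables. The parameter of Z_{k+i;k} exceeds that of
   Y_i by at most q^-k q^-i, so replacing one by the other changes the mean of a
   bounded function by O(q^-k), uniformly in the number of summands; and the
   infinite sums are almost surely finite by Borel-Cantelli. *)

(** * Codes of permutations *)

Lemma inversions_sum_below n (s : 'S_n) :
  inversions s = (\sum_(j < n) inversions_below s j)%N.
Proof.
(* Positions are replaced by the values they carry; the order condition and the summand then trade
   places, so that an inversion is counted at its larger value. *)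
rewrite /inversions (reindex_inj (@perm_inj _ (s^-1)%g)).
apply: eq_bigr => a _; rewrite /inversions_below.
rewrite (reindex_inj (@perm_inj _ (s^-1)%g)) [LHS]big_mkcond [RHS]big_mkcond.
apply: eq_bigr => b _; rewrite !permKV.
by case: (_ < _)%N; case: (_ < _)%N.
Qed.

(** The Lehmer code of [s], listed by values instead of positions. *)
Definition code n (s : 'S_n) : {ffun 'I_n -> 'I_n} :=
  [ffun j => Ordinal (inversions_below_lt s j)].

(* The place of the position of j among those of the values below j can be read
   off from inversions_below s j, so the code determines, by induction on j, the
   relative order of the positions of the values up to j. *)
Lemma inversions_below_ltE n (s : 'S_n) (i j : 'I_n) : (i < j)%N ->
  ((s^-1)%g j < (s^-1)%g i)%N =
  (\sum_(a < n | (a < j)%N) ((s^-1)%g i < (s^-1)%g a)%N < inversions_below s j)%N.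
Proof.
move=> ij; set u := (s^-1)%g.
have uij : u i != u j :> nat.
  rewrite (inj_eq val_inj) (inj_eq perm_inj); apply: contraTneq ij => ->.
  by rewrite ltnn.
apply/idP/idP => [uji|].
  (* Every value located after [i] is located after [j] too, and [i] itself makes the inequality
     strict. *)
  rewrite /inversions_below (bigD1 i)//= [X in (_ < X)%N](bigD1 i)//= ltnn -/u uji.
  rewrite add0n add1n ltnS; apply: leq_sum => a _.
  by case: ltnP => // ua; rewrite (ltn_trans uji ua).
apply: contraTT; rewrite -!leqNgt => uij'.
apply: leq_sum => a _.
by case: ltnP => // ua; rewrite (leq_ltn_trans uij' ua).
Qed.

Lemma code_inj n : injective (@code n).
Proof.
move=> s t st.
have stE j : inversions_below s j = inversions_below t j.
  by move/ffunP: st => /(_ j); rewrite !ffunE => /(congr1 val).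
pose u := (s^-1)%g; pose v := (t^-1)%g.
have uv : forall m (i j : 'I_n), (i < m)%N -> (j < m)%N ->
    (u i < u j)%N = (v i < v j)%N.
  elim=> // m IH i j; rewrite !ltnS.
  have key (a b : 'I_n) : (a < b)%N -> (b <= m)%N ->
      (u b < u a)%N = (v b < v a)%N.
    move=> ab bm; rewrite !inversions_below_ltE// stE; congr (_ < _)%N.
    apply: eq_bigr => c cb; rewrite -/u -/v IH//; exact: leq_trans bm.
  have ntle (w : 'S_n) (a b : 'I_n) : (a < b)%N -> (w a < w b)%N = ~~ (w b < w a)%N.
    move=> ab; rewrite -leqNgt [RHS]leq_eqVlt (inj_eq val_inj) (inj_eq perm_inj).
    by case: eqP => // abE; move: ab; rewrite abE ltnn.
  move=> im jm; case: (ltngtP i j) => [ij|ji|/val_inj->]; last by rewrite !ltnn.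
    by rewrite !(ntle _ _ _ ij) key.
  exact: key.
(* Each [w i] is its rank among the values of [w], so the relative order given by [uv] determines
   the permutation. *)
have rk (w : 'S_n) (i : 'I_n) : (w i = \sum_(a < n) (w a < w i)%N :> nat)%N.
  rewrite -(reindex_inj (P := xpredT)
    (F := fun b : 'I_n => nat_of_bool (b < w i)%N) (@perm_inj _ w)).
  rewrite -(big_mkord xpredT (fun b => nat_of_bool (b < w i)%N)).
  rewrite (big_cat_nat (n := w i))//= ?(ltnW (ltn_ord _))//.
  rewrite [X in (_ + X)%N]big_nat_cond [X in (_ + X)%N]big1 ?addn0; last first.
    by move=> b /andP[/andP[wb _] _]; rewrite ltnNge wb.
  rewrite (eq_big_nat _ _ (F2 := fun => 1%N)); last by move=> b /andP[_ ->].
  by rewrite sum_nat_const_nat subn0 muln1.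
apply: invg_inj; apply/permP => i; apply: val_inj.
rewrite /= -/u -/v (rk u) (rk v).
by apply: eq_bigr => a _; rewrite (uv n).
Qed.

(** One inclusion is [inversions_below_le]; equality follows by counting, as [code] is injective and
    both sides have [n!] elements. *)
Lemma code_image n :
  [set code s | s : 'S_n]%SET =
  [set f in family (fun j : 'I_n => [pred c : 'I_n | (c <= j)%N])]%SET.
Proof.
apply/eqP; rewrite eqEcard; apply/andP; split.
  apply/fintype.subsetP => _ /imsetP[s _ ->]; rewrite inE; apply/familyP => j.
  by rewrite ffunE inE; exact: inversions_below_le.
rewrite card_imset; last exact: code_inj.
rewrite cardsE card_family card_Sn foldrE big_image/=.
rewrite fact_prod big_add1/= big_mkord.
apply/eq_leq/eq_bigr => j _.
rewrite -sum1_card (eq_bigl (fun c : 'I_n => (c < j.+1)%N)); last by [].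
by rewrite -(big_ord_widen n (fun=> 1%N))// sum1_card card_ord.
Qed.

(** Expanding the product of sums gives a sum over all choices of [c j <= j], which by [code_image]
    are the codes. This expresses the independence of the code entries in the form that generating
    polynomials use. *)
Lemma sum_prod_inversions_below (A : comPzSemiRingType) n (F : 'I_n -> nat -> A) :
  \sum_(s : 'S_n) \prod_(j < n) F j (inversions_below s j) =
  \prod_(j < n) \sum_(c < j.+1) F j c.
Proof.
under [RHS]eq_bigr => j _.
  rewrite (big_ord_widen n (F j))//.
  over.
rewrite bigA_distr_big_dep/=.
rewrite [RHS](eq_bigl [in [set code s | s : 'S_n]%SET]); last first.
  by move=> f; rewrite code_image inE.
rewrite big_imset/=; last by move=> s t _ _; exact: code_inj.
by apply: eq_bigr => s _; apply: eq_bigr => j _; rewrite ffunE.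
Qed.

(** The generating polynomial of one Bernoulli variable with parameter [p]. *)
Definition bern_poly (R : nzRingType) (p : R) : {poly R} := (1 - p)%:P + p *: 'X.

(* The generating polynomial of a sum of n independent Bernoulli variables with
   parameters p 0, ..., p (n - 1). *)
Definition bern_prod (R : nzRingType) (p : nat -> R) (n : nat) : {poly R} :=
  \prod_(0 <= j < n) bern_poly (p j).

Definition code_count n k (s : 'S_n) : nat :=
  (\sum_(j < n) (inversions_below s j == k))%N.

(** The q-analogue of the integer [j]. *)
Definition qnat (R : pzSemiRingType) (q : R) j : R := \sum_(c < j) q ^+ c.

(** * The generating polynomial of [code_count] under the Mallows weights *)

Section mallows_generating_function.
Variables (R : realType) (q : R) (n k : nat).
Hypothesis q0 : 0 < q.

Let qnat_neq0 (j : nat) : qnat q j.+1 != 0.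
Proof.
rewrite gt_eqF// /qnat big_ord_recl expr0 ltr_pwDl// sumr_ge0// => c _.
by rewrite exprn_ge0// ltW.
Qed.

Lemma sum_exp_inversions :
  \sum_(s : 'S_n) q ^+ inversions s = \prod_(j < n) qnat q j.+1.
Proof.
rewrite -(sum_prod_inversions_below (fun _ c => q ^+ c)).
by apply: eq_bigr => s _; rewrite inversions_sum_below -prodrXr.
Qed.

(** Marking each code entry equal to [k] by ['X] turns the weighted sum over permutations into a
    product over [j], whose factors with [k <= j] are Bernoulli polynomials up to the scalar
    [qnat q j.+1]. *)
Lemma code_count_coef i :
  \sum_(s : 'S_n | code_count k s == i)
    q ^+ inversions s / \sum_(r : 'S_n) q ^+ inversions r =
  (bern_prod (fun j => q ^+ k / qnat q (k + j).+1) (n - k))`_i.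
Proof.
rewrite /bern_prod sum_exp_inversions -mulr_suml.
set K := \prod_(_ < _) _.
have K0 : K != 0 by apply/prodf_neq0 => j _; exact: qnat_neq0.
apply: (canLR (mulfK K0)); rewrite mulrC -coefZ.
have -> : K *: \prod_(0 <= j < n - k) bern_poly (q ^+ k / qnat q (k + j).+1) =
    \sum_(s : 'S_n) q ^+ inversions s *: 'X^(code_count k s).
  have -> : \sum_(s : 'S_n) q ^+ inversions s *: 'X^(code_count k s) =
     \sum_(s : 'S_n) \prod_(j < n)
        (fun _ c => q ^+ c *: 'X^(c == k) : {poly R}) j (inversions_below s j).
    apply: eq_bigr => s _; rewrite scaler_prod prodrXr -inversions_sum_below.
    by rewrite prodrXr.
  rewrite (sum_prod_inversions_below
    (fun _ c => q ^+ c *: 'X^(c == k) : {poly R})).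
  (* An entry with [j < k] never reaches [k], so its factor is constant; otherwise the single term
     [c = k] carries the indeterminate. *)
  rewrite (eq_bigr (fun j : 'I_n => qnat q j.+1 *:
     (if (k <= j)%N then bern_poly (q ^+ k / qnat q j.+1) else 1))); last first.
    move=> j _; case: leqP => kj.
      have kj' : (k < j.+1)%N by [].
      have -> : qnat q j.+1 *: bern_poly (q ^+ k / qnat q j.+1) =
          (qnat q j.+1 - q ^+ k)%:P + q ^+ k *: 'X.
        rewrite scalerDr scalerA mulrCA mulfV// mulr1; congr (_ + _).
        by rewrite -mul_polyC -polyCM mulrBr mulr1 mulrCA mulfV// mulr1.
      rewrite (bigD1 (Ordinal kj'))//= eqxx expr1 addrC; congr (_ + _).
      have -> : qnat q j.+1 - q ^+ k = \sum_(c < j.+1 | c != Ordinal kj') q ^+ c.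
        by rewrite /qnat (bigD1 (Ordinal kj'))//= addrAC subrr add0r.
      rewrite rmorph_sum/=.
      apply: eq_bigr => c; rewrite -(inj_eq val_inj)/= => /negPf->.
      by rewrite expr0 alg_polyC.
    rewrite alg_polyC rmorph_sum/=; apply: eq_bigr => c _.
    rewrite ltn_eqF ?expr0 ?alg_polyC//.
    exact: leq_ltn_trans (leq_ord c) kj.
  rewrite scaler_prod; congr (_ *: _).
  rewrite -big_mkcond/= -(big_mkord (fun j => (k <= j)%N)
    (fun j => bern_poly (q ^+ k / qnat q j.+1))).
  (* If [n < k], no index satisfies [k <= j < n] and the truncated [n - k] is 0, so both products
     are empty. *)
  have [kn|nk] := leqP k n; last first.
    rewrite (eqP (ltnW nk)) big_geq// big_nat_cond big_pred0// => j.
    by apply/negP => /andP[/andP[_ jn]]; rewrite leqNgt (ltn_trans jn nk).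
  rewrite [RHS](big_cat_nat (n := k))//= [X in _ = X * _]big_nat_cond.
  rewrite [X in _ = X * _]big_pred0 ?mul1r; last first.
    by move=> j; apply/negP => /andP[/andP[_ jn]]; rewrite leqNgt jn.
  rewrite -[X in _ = \big[_/_]_(X <= _ < _ | _) _]add0n big_addn [RHS]big_mkcond.
  by apply: eq_bigr => j _; rewrite leq_addl addnC.
rewrite coef_sum [LHS]big_mkcond; apply: eq_bigr => s _.
by rewrite coefZ coefXn eq_sym; case: eqP => _; rewrite ?mulr1 ?mulr0.
Qed.

End mallows_generating_function.

(* The mean of f S, for a sum S with generating polynomial bern_prod p n. *)
Definition bern_mean (R : nzRingType) (p : nat -> R) (f : nat -> R) (n : nat) : R :=
  \sum_(i < n.+1) (bern_prod p n)`_i * f i.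

(** * Means of functions of Bernoulli sums *)

Section bern_mean_theory.
Variable R : realDomainType.
Implicit Types (p : nat -> R) (f : nat -> R).

Lemma coef_mul_bern_poly (P : {poly R}) a i :
  (P * bern_poly a)`_i = (1 - a) * P`_i + a * (if i is j.+1 then P`_j else 0).
Proof.
rewrite /bern_poly mulrDr coefD coefMC mulrC; congr (_ + _).
by rewrite -scalerAr coefZ coefMX; case: i.
Qed.

Lemma bern_prodS p n : bern_prod p n.+1 = bern_prod p n * bern_poly (p n).
Proof. by rewrite /bern_prod big_nat_recr. Qed.

Lemma size_bern_prod p n : (size (bern_prod p n) <= n.+1)%N.
Proof.
elim: n => [|n IH]; first by rewrite /bern_prod big_geq// size_poly1.
rewrite bern_prodS (leq_trans (size_polyMleq _ _))//.
have s2 : (size (bern_poly (p n)) <= 2)%N.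
  rewrite (leq_trans (size_polyD _ _))// geq_max.
  rewrite (leq_trans (size_polyC_leq1 _))//=.
  by rewrite (leq_trans (size_scale_leq _ _))// size_polyX.
by rewrite -subn1 leq_subLR (leq_trans (leq_add IH s2))// addn2.
Qed.

Lemma bern_mean0 p f : bern_mean p f 0 = f 0.
Proof. by rewrite /bern_mean big_ord1 /bern_prod big_geq// coef1 mul1r. Qed.

(** Conditioning on the last variable, which adds 1 to the argument of [f] with probability
    [p n]. *)
Lemma bern_meanS p f n : bern_mean p f n.+1 =
  (1 - p n) * bern_mean p f n + p n * bern_mean p (f \o S) n.
Proof.
rewrite /bern_mean bern_prodS.
under eq_bigr => i _ do rewrite coef_mul_bern_poly mulrDl -!mulrA.
rewrite big_split/= -!mulr_sumr; congr (_ * _ + _ * _).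
  (* The coefficient of index [n.+1] lies beyond the size of [bern_prod p n]. *)
  by rewrite big_ord_recr/= nth_default ?mul0r ?addr0// size_bern_prod.
by rewrite big_ord_recl/= mul0r add0r.
Qed.

Lemma bern_mean_bound p f (M : R) n : (forall i, 0 <= p i <= 1) ->
  (forall i, `|f i| <= M) -> `|bern_mean p f n| <= M.
Proof.
move=> p01; elim: n f => [|n IH] f fM; first by rewrite bern_mean0.
have /andP[p0 p1] := p01 n.
rewrite bern_meanS (le_trans (ler_normD _ _))// !normrM.
rewrite (ger0_norm p0) (ger0_norm (_ : 0 <= 1 - p n)) ?subr_ge0//.
have -> : M = (1 - p n) * M + p n * M by rewrite -mulrDl subrK mul1r.
by rewrite lerD// ler_wpM2l ?subr_ge0// IH// => i; exact: fM.
Qed.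

(** Exchanging the last parameter changes the mean by [p n - p' n] times a difference of two means
    bounded by [M], whence the factor 2; the other parameters are handled by induction. *)
Lemma bern_mean_lipschitz p p' f (M : R) n : (forall i, 0 <= p i <= 1) ->
  (forall i, 0 <= p' i <= 1) -> (forall i, `|f i| <= M) ->
  `|bern_mean p f n - bern_mean p' f n| <=
    M *+ 2 * \sum_(0 <= i < n) `|p i - p' i|.
Proof.
move=> p01 p'01; elim: n f => [|n IH] f fM.
  by rewrite !bern_mean0 subrr normr0 big_geq// mulr0.
have fM' : forall i, `|(f \o S) i| <= M by move=> i; exact: fM.
have /andP[p0 p1] := p01 n.
have := IH _ fM; have := IH _ fM'.
have := bern_mean_bound n p'01 fM; have := bern_mean_bound n p'01 fM'.
rewrite !bern_meanS big_nat_recr//= mulrDr.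
set A := bern_mean p f n; set B := bern_mean p _ n.
set A' := bern_mean p' f n; set B' := bern_mean p' _ n.
set D := _ * \sum_(_ <= _ < _) _ => bB' bA' BB' AA'.
have -> : (1 - p n) * A + p n * B - ((1 - p' n) * A' + p' n * B') =
  (1 - p n) * (A - A') + p n * (B - B') + (p n - p' n) * (B' - A') by ring.
rewrite (le_trans (ler_normD _ _))// lerD//.
  rewrite (le_trans (ler_normD _ _))// !normrM.
  rewrite (ger0_norm p0) (ger0_norm (_ : 0 <= 1 - p n)) ?subr_ge0//.
  have -> : D = (1 - p n) * D + p n * D by rewrite -mulrDl subrK mul1r.
  by rewrite lerD// ler_wpM2l ?subr_ge0.
by rewrite normrM mulrC ler_wpM2r// mulr2n (le_trans (ler_normB _ _))// lerD.
Qed.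

Lemma sum_coef_bern_prod p n : \sum_(i < n.+1) (bern_prod p n)`_i = 1.
Proof.
have : bern_mean p (fun=> 1) n = 1.
  elim: n => [|n IH]; first by rewrite bern_mean0.
  by rewrite bern_meanS IH !mulr1 subrK.
by move=> <-; apply: eq_bigr => i _; rewrite mulr1.
Qed.

End bern_mean_theory.

(* The parameter of Z_{k+i;k}. *)
Definition Zparam (R : fieldType) (q : R) (k i : nat) : R :=
  (q - 1) * q ^+ (k - 1) / (q ^+ (k + i) - 1).

(** For [1 < q] this is the limit of [Zparam q k i] as [k] tends to infinity. *)
Definition Yparam (R : fieldType) (q : R) (i : nat) : R := (q - 1) / q ^+ i.+1.

(** The geometric sum [(q - 1) * qnat q j = q ^+ j - 1], with the 1-based value [k] turned into the
    0-based entry [k - 1]. *)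
Lemma Zparam_qnat (R : fieldType) (q : R) k i : q != 1 -> (0 < k)%N ->
  q ^+ (k - 1) / qnat q (k - 1 + i).+1 = Zparam q k i.
Proof.
move=> q1; case: k => // k _; rewrite subSS subn0 /Zparam subSS subn0 addSn.
by rewrite subrX1 -/(qnat q (k + i).+1) invfM mulrACA mulfV ?subr_eq0// mul1r.
Qed.

(** * The law of the number of occurrences *)

Section law_of_occurrences.
Variables (R : realType) (q : {posnum R}).

(** The second permutation only rearranges the code of the first, so the count depends on [st.1]
    alone. *)
Lemma occurrences_park n k (st : 'S_n * 'S_n) : (0 < k)%N ->
  occurrences R k (park st) = (code_count (k - 1)%N st.1)%:R.
Proof.
move=> k0; rewrite /occurrences; congr (_%:R).
rewrite -sum1_card big_mkcond/= /code_count.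
rewrite [RHS](reindex_inj (@perm_inj _ st.2)); apply: eq_bigr => j _.
by rewrite inE ffunE/= -{1}(prednK k0) eqSS subn1; case: eqP.
Qed.

Lemma mallows_code_count n k i :
  mallows n q [set s | code_count k s = i] =
  ((bern_prod (fun j => q%:num ^+ k / qnat q%:num (k + j).+1) (n - k)%N)`_i)%:E.
Proof.
rewrite -code_count_coef// -sumEFin.
rewrite /mallows/= /weighted fsbig_mkcond (fsbigE (enum 'S_n)) ?enum_uniq//.
  under eq_bigl do rewrite in_setT.
  rewrite big_enum/= [RHS]big_mkcond/=; apply: eq_bigr => s _.
  by rewrite patchE; congr (if _ then _ else _); apply/idP/eqP; rewrite inE.
by move=> s _; rewrite mem_enum.
Qed.

(** For [k <= n] the number of summands [n - (k - 1)] is [n - k + 1]; for [k > n] it is 0, as the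
    value [k] then never occurs. *)
Lemma occurrences_law1 n k i : q%:num != 1 -> (0 < k)%N ->
  occurrences_law n q k [set i%:R] =
  ((bern_prod (Zparam q%:num k) (n - (k - 1))%N)`_i)%:E.
Proof.
move=> q1 k0.
(* The event leaves the second permutation free, so the uniform factor contributes mass 1. *)
rewrite (_ : occurrences_law n q k [set i%:R] =
  (mallows n q \x uniform_perm n)%E
    ([set s | code_count (k - 1)%N s = i] `*` [set: 'S_n])).
  rewrite product_measure1E// [X in (_ * X)%E](probability_setT (uniform_perm n)).
  rewrite mule1 [LHS]mallows_code_count.
  congr ((polyseq _)`_i)%:E; apply: eq_bigr => j _.
  by rewrite Zparam_qnat.
rewrite /occurrences_law/= /distribution/= /pushforward/=.
congr ((mallows n q \x uniform_perm n)%E _).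
apply/seteqP; split => -[s t]/=; rewrite occurrences_park//=.
  by move/eqP; rewrite eqr_nat => /eqP.
by case=> ->.
Qed.

End law_of_occurrences.

(** * Laws carried by finitely many natural numbers *)

Section laws_on_nat.
Variable R : realType.

Lemma bounded_fun_le (f : R -> R) : bounded_fun f -> exists M : R, forall x, `|f x| <= M.
Proof.
by move=> /pinfty_ex_gt0[M _ fM]; exists M => x; exact: fM.
Qed.

Lemma bounded_integrable d (T : measurableType d) (P : probability T R)
    (f : T -> R) (M : R) :
  measurable_fun setT f -> (forall x, `|f x| <= M) ->
  P.-integrable setT (EFin \o f).
Proof.
move=> mf fM; apply: measurable_bounded_integrable => //.
  by rewrite [X in (X < _)%E](probability_setT P) ltry.
exists M; split; first exact: num_real.
by move=> N MN x _; rewrite /= (le_trans (fM _))// ltW.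
Qed.

(** The masses add up to 1, so the complement of the finite set [D] of atoms is negligible and only
    the sum over the atoms remains. *)
Lemma integral_nat_law (mu : probability R R) (f : R -> R) (a : nat -> R) n :
  continuous f -> bounded_fun f ->
  (forall i : nat, (i < n)%N -> mu [set i%:R] = (a i)%:E) ->
  \sum_(i < n) a i = 1 ->
  (\int[mu]_x (f x)%:E)%E = (\sum_(i < n) a i * f i%:R)%:E.
Proof.
move=> cf bf mua a1.
pose D := \big[setU/set0]_(i <- iota 0 n) [set i%:R : R].
have mf : measurable_fun setT f by exact: continuous_measurable_fun.
have mD : measurable D by exact: bigsetU_measurable.
have tD : trivIset [set` iota 0 n] (fun i : nat => [set i%:R : R]).
  move=> i j _ _ [x [/= -> /eqP]].
  by rewrite eqr_nat => /eqP.
have sumE (g : nat -> \bar R) : (\sum_(i <- iota 0 n) g i = \sum_(i < n) g i)%E.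
  by rewrite -(big_mkord xpredT) /index_iota subn0.
have intD (g : R -> R) : measurable_fun setT g ->
    (\int[mu]_(x in D) (g x)%:E)%E = (\sum_(i < n) a i * g i%:R)%:E.
  move=> mg; rewrite integral_bigsetU_EFin//; last first.
  - by apply/measurable_EFinP; exact: measurable_funTS.
  - exact: iota_uniq.
  rewrite sumE -sumEFin; apply: eq_bigr => i _.
  rewrite (eq_integral (cst (g i%:R)%:E)); last by move=> x; rewrite inE => ->.
  by rewrite integral_cst// [X in (_ * X)%E](mua i (ltn_ord i)) -EFinM mulrC.
(* The mass of [D] is [intD] for the constant function 1. *)
have muD : mu D = 1%E.
  have := intD (cst 1) (measurable_cst _).
  rewrite [X in X = _ -> _](integral_cst mu mD 1) mul1e => ->.
  by under eq_bigr do rewrite mulr1; rewrite a1.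
have muDC : mu (~` D) = 0%E by rewrite probability_setC// muD subee.
rewrite (negligible_integral (N := ~` D))//; last 2 first.
- exact: measurableC.
- by have [M fM] := bounded_fun_le bf; exact: (bounded_integrable mu mf fM).
by rewrite setTD setCK intD.
Qed.

End laws_on_nat.

(** * Finite and infinite sums of independent Bernoulli variables *)

Section independent_bernoulli_sums.
Context {R : realType} {d} {T : measurableType d} (P : probability T R).
Variables (X : nat -> {RV P >-> bool}) (m : nat) (p : nat -> R).
Hypothesis indX : independent_RVs [set j | (m <= j)%N] X.
Hypothesis pX : forall i, P (X (m + i)%N @^-1` [set true]) = (p i)%:E.

Let count n x : nat := (\sum_(m <= j < m + n) X j x)%N.

Let partial_sumE n x : partial_sum X m (m + n) x = (count n x)%:R.
Proof. by rewrite /partial_sum natr_sum. Qed.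

Let mX j B : measurable (X j @^-1` B).
Proof. exact: measurable_funPTI. Qed.

Let mcount n i : measurable [set x | count n x = i].
Proof.
rewrite (_ : [set x | _] = partial_sum X m (m + n) @^-1` [set i%:R]).
  exact: measurable_funPTI.
apply/seteqP; split=> x /=; rewrite partial_sumE; first by move->.
by move/eqP; rewrite eqr_nat => /eqP.
Qed.

Let pX_false i : P (X (m + i)%N @^-1` [set false]) = (1 - p i)%:E.
Proof.
rewrite (_ : _ @^-1` _ = ~` (X (m + i)%N @^-1` [set true])).
  by rewrite probability_setC// pX.
by apply/seteqP; split=> x /=; case: (X _ x).
Qed.

(* The extra events on the variables beyond m + n feed the induction on n. *)
Let count_joint n : forall i (J : {fset nat}) (A : nat -> set bool),
  (forall j, j \in J -> (m + n <= j)%N) ->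
  P ([set x | count n x = i] `&` \bigcap_(j in [set` J]) (X j @^-1` A j)) =
  (((bern_prod p n)`_i)%:E * \prod_(j <- J) P (X j @^-1` A j))%E.
Proof.
elim: n => [|n IH] i J A Jm.
  have c0 x : count 0 x = 0%N by rewrite /count addn0 big_geq.
  rewrite /bern_prod big_geq// coef1; case: i => [|i]/=.
    rewrite mul1e -indX//; last by move=> j /Jm; rewrite addn0.
    congr (P _); apply/seteqP; split=> x /=; first by case.
    by move=> Ax; split=> //; exact: c0.
  rewrite mul0e (_ : _ `&` _ = set0) ?measure0//.
  by apply/seteqP; split=> x //= -[]; rewrite c0.
have mnJ : (m + n)%N \notin J.
  by apply/negP => /Jm; rewrite addnS ltnn.
(* [A' b] adds the event that the next variable equals [b], so that the induction hypothesis for the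
   enlarged index set absorbs it. *)
pose A' b j := if j == (m + n)%N then [set b] else A j.
have A'J b j : j \in J -> A' b j = A j.
  by rewrite /A'; case: eqP => // -> /(negP mnJ).
have step b k : P ([set x | count n x = k] `&` X (m + n)%N @^-1` [set b] `&`
      \bigcap_(j in [set` J]) (X j @^-1` A j)) =
    (((bern_prod p n)`_k)%:E * P (X (m + n)%N @^-1` [set b]) *
     \prod_(j <- J) P (X j @^-1` A j))%E.
  have A'mn : A' b (m + n)%N = [set b] by rewrite /A' eqxx.
  have -> : \bigcap_(j in [set` J]) (X j @^-1` A j) =
      \bigcap_(j in [set` J]) (X j @^-1` A' b j).
    by apply: eq_bigcapr => j jJ; rewrite A'J.
  have -> : (\prod_(j <- J) P (X j @^-1` A j) =
      \prod_(j <- J) P (X j @^-1` A' b j))%E.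
    by apply: eq_big_seq => j jJ; rewrite A'J.
  have := IH k ((m + n)%N |` J)%fset (A' b).
  rewrite bigcap_fsetU1 big_fsetU1//= setIA muleA A'mn.
  apply=> j; rewrite !inE => /orP[/eqP->//|/Jm]; rewrite addnS; exact: ltnW.
set C := \bigcap_(j in _) _.
have mC : measurable C.
  by rewrite /C bigcap_fset; apply: bigsetI_measurable.
(* The event is split by the value of the next variable; when it is true, the earlier ones count one
   less. *)
have -> : [set x | count n.+1 x = i] `&` C =
    ([set x | count n x = i] `&` X (m + n)%N @^-1` [set false] `&` C) `|`
    ([set x | (count n x).+1 = i] `&` X (m + n)%N @^-1` [set true] `&` C).
  apply/seteqP; split=> x /=; rewrite /count addnS big_nat_recr ?leq_addr//=.
    by case: (X _ x) => -[ni Cx]; rewrite ?addn1 ?addn0 in ni; [right|left].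
  by case=> -[[ni ->] Cx]; rewrite ?addn1 ?addn0.
have mcountS : measurable [set x | (count n x).+1 = i].
  case: i => [|i]; first by rewrite (_ : [set x | _] = set0)//; apply/seteqP; split.
  rewrite (_ : [set x | _] = [set x | count n x = i]); first exact: mcount.
  by apply/seteqP; split=> x /=; [case|move->].
rewrite measureU; first last.
- by apply/seteqP; split=> x //= [[[_ ->] _] [[_ //]]].
- by apply: measurableI => //; apply: measurableI.
- by apply: measurableI => //; apply: measurableI => //; exact: mcount.
rewrite [X in (X + _)%E]step pX_false bern_prodS coef_mul_bern_poly.
rewrite [X in (_ + X)%E](_ : _ =
   (if i is j.+1 then (bern_prod p n)`_j else 0)%:E * (p n)%:E *
     \prod_(j <- J) P (X j @^-1` A j))%E; last first.
  case: (i) => [|k].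
    rewrite !mul0e (_ : _ `&` _ = set0) ?measure0//.
    by apply/seteqP; split=> x //= -[[]].
  rewrite -pX -step; congr (P (_ `&` _ `&` _)).
  by apply/seteqP; split=> x /=; [case|move->].
(* The product is finite; naming it as a real lets the identity be checked in [R]. *)
have [r ->] : exists r, (\prod_(j <- J) P (X j @^-1` A j) = r%:E)%E.
  elim/big_ind: _ => [|_ _ [r ->] [s ->]|j _]; first by exists 1.
    by exists (r * s).
  by exists (fine (P (X j @^-1` A j))); rewrite fineK ?fin_num_measure.
by rewrite -!EFinM -EFinD [in RHS]mulrDl [(1 - p n) * _]mulrC [p n * _]mulrC.
Qed.

Lemma integral_partial_sum_law n (f : R -> R) :
  continuous f -> bounded_fun f ->
  (\int[partial_sum_law X m (m + n)]_x (f x)%:E)%E =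
  (bern_mean p (fun i => f i%:R) n)%:E.
Proof.
move=> cf bf; apply: integral_nat_law => //; last exact: sum_coef_bern_prod.
move=> i _.
(* An empty [J] leaves the law of the count alone. *)
have := @count_joint n i fset0 (fun=> setT).
rewrite big_seq_fset0 mule1 => <- //.
rewrite /partial_sum_law/= /distribution/= /pushforward/=; congr (P _).
apply/seteqP; split=> x /=; rewrite partial_sumE.
  by move/eqP; rewrite eqr_nat => /eqP.
by case=> ->.
Qed.

Variable C : R.
Hypothesis sum_p : forall n, \sum_(0 <= i < n) p i <= C.

(** Borel-Cantelli: the probabilities of the value [true] have sum at most [C]. *)
Lemma ae_eventually_false :
  {ae P, forall x, exists n, forall i, (n <= i)%N -> X (m + i)%N x = false}.
Proof.
pose F i := X (m + i)%N @^-1` [set true].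
have mF i : measurable (F i) by exact: mX.
exists (lim_sup_set F); split.
- apply: bigcap_measurable => // n _.
  exact: bigcup_measurable.
- apply: lim_sup_set_cvg0 => //; apply: (@le_lt_trans _ _ C%:E); last exact: ltry.
  apply: lime_le; first exact: is_cvg_nneseries.
  apply: nearW => n; rewrite (eq_bigr (fun i => (p i)%:E)); last first.
    by move=> i _; exact: pX.
  by rewrite sumEFin lee_fin.
- move=> x /= nx n _; apply: contrapT => nX; apply: nx; exists n => i ni.
  by apply/negP => Xi; apply: nX; exists i.
Qed.

Lemma infinite_sumE x n : (forall i, (n <= i)%N -> X (m + i)%N x = false) ->
  infinite_sum X m x = (partial_sum X m (m + n) x)%:E.
Proof.
move=> Xn; rewrite /infinite_sum (nneseries_split _ n); last by [].
rewrite eseries0; first by rewrite adde0 sumEFin.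
move=> j mnj _; have mj := leq_trans (leq_addr n m) mnj.
by rewrite -(subnKC mj) Xn// leq_subRL.
Qed.

(** Off the null set of [ae_eventually_false] the series has finitely many nonzero terms, hence
    equals a finite count. *)
Lemma infinite_sum_nat :
  P [set x | exists k : nat, infinite_sum X m x = k%:R%:E] = 1%E.
Proof.
set A := [set x | _].
have mA : measurable A.
  rewrite (_ : A = \bigcup_k (infinite_sum X m @^-1` [set k%:R%:E])).
    by apply: bigcup_measurable => k _; exact: measurable_funPTI.
  by apply/seteqP; split=> x [k]; [exists k|move=> _; exists k].
suff : P (~` A) = 0%E.
  have fA : P A \is a fin_num by exact: fin_num_measure.
  by rewrite probability_setC// -(fineK fA) => -[/eqP]; rewrite subr_eq0 => /eqP<-.
apply/negligibleP; first exact: measurableC.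
apply: negligibleS ae_eventually_false => x Ax /= -[n Xn]; apply: Ax.
by exists (count n x); rewrite (infinite_sumE Xn) partial_sumE.
Qed.

(** Almost surely the partial sums are eventually constant, so [f] of them converges; dominated
    convergence applies with a constant bound of [f]. *)
Lemma cvg_bern_mean (f : R -> R) : continuous f -> bounded_fun f ->
  ((bern_mean p (fun i => f i%:R) n)%:E @[n --> \oo] -->
   \int[infinite_sum_law X m]_x (f x)%:E)%E.
Proof.
move=> cf bf; have [M fM] := bounded_fun_le bf.
have mf : measurable_fun setT f by exact: continuous_measurable_fun.
have mS : measurable_fun setT (real_infinite_sum X m) by [].
have mP n : measurable_fun setT (partial_sum X m n) by [].
rewrite /infinite_sum_law integral_distribution//; last 2 first.
- exact/measurable_EFinP.
- by apply: (@bounded_integrable _ _ _ P _ M) => //; exact: measurableT_comp.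
rewrite (_ : (fun n => _) = fun n =>
    (\int[P]_x (EFin \o (f \o partial_sum X m (m + n))) x)%E); last first.
  apply/funext => n; rewrite -integral_partial_sum_law//.
  rewrite /partial_sum_law integral_distribution//.
    exact/measurable_EFinP.
  by apply: (@bounded_integrable _ _ _ P _ M) => //; exact: measurableT_comp.
have [] // := @dominated_convergence _ _ _ P setT measurableT
  (fun n => EFin \o (f \o partial_sum X m (m + n)))
  (EFin \o (f \o real_infinite_sum X m)) (cst M%:E).
- by move=> n; apply/measurable_EFinP; exact: measurableT_comp.
- by apply/measurable_EFinP; exact: measurableT_comp.
- apply: filterS ae_eventually_false => x [n Xn] _.
  apply: cvg_near_cst; near=> k.
  rewrite /= /real_infinite_sum (@infinite_sumE x k)// => i ki.
  apply: Xn; apply: leq_trans ki; near: k; exact: nbhs_infty_ge.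
- exact: (finite_measure_integrable_cst P M).
- by apply: aeW => x n _; rewrite /= lee_fin; exact: fM.
Unshelve. all: by end_near.
Qed.

End independent_bernoulli_sums.

(** * Estimates on the parameters and on the resulting means *)

Section parameters.
Variables (R : realType) (q : R).
Hypothesis q1 : 1 < q.

Let q0 : 0 < q. Proof. exact: lt_trans q1. Qed.

Let qX_gt0 n : 0 < q ^+ n. Proof. exact: exprn_gt0. Qed.

Let qX_ge1 n : 1 <= q ^+ n. Proof. exact/exprn_ege1/ltW. Qed.

Lemma Yparam_bounds i : 0 <= Yparam q i <= q^-1 ^+ i.
Proof.
rewrite /Yparam divr_ge0 ?subr_ge0 ?(ltW q1) ?(ltW (qX_gt0 _))//=.
rewrite ler_pdivrMr// exprVn exprS.
by rewrite mulrCA mulVf ?gt_eqF// mulr1 gerBl.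
Qed.

Lemma Zparam_sub_Yparam k i : (0 < k)%N ->
  0 <= Zparam q k i - Yparam q i <= q^-1 ^+ k * q^-1 ^+ i.
Proof.
case: k => // k _; rewrite /Zparam /Yparam subSS subn0 addSn.
rewrite !exprVn -invfM !exprS exprD.
have b0 := qX_gt0 k; have b1 := qX_ge1 k.
have c0 := qX_gt0 i; have c1 := qX_ge1 i.
move: (q ^+ k) (q ^+ i) b0 b1 c0 c1 => b c b0 b1 c0 c1.
(* Here [b] is [q] to the original [k] minus one, and [c] is [q ^+ i]. The upper bound amounts to
   this inequality, which follows from [1 <= b] and [1 <= c]. *)
have bD : (q - 1) * b <= q * (b * c) - 1.
  rewrite mulrBl mul1r mulrA lerB// ler_peMr// ltW// mulr_gt0//.
have D0 : 0 < q * (b * c) - 1.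
  by apply: lt_le_trans bD; rewrite mulr_gt0// subr_gt0.
have -> : (q - 1) * b / (q * (b * c) - 1) - (q - 1) / (q * c) =
    (q - 1) / (q * c * (q * (b * c) - 1)).
  by field; rewrite !gt_eqF.
apply/andP; split.
  by rewrite divr_ge0 ?subr_ge0 ?(ltW q1)// ltW// !mulr_gt0.
rewrite ler_pdivrMr ?mulr_gt0//.
have -> : (q * b * c)^-1 * (q * c * (q * (b * c) - 1)) = (q * (b * c) - 1) / b.
  by field; rewrite !gt_eqF.
by rewrite ler_pdivlMr.
Qed.

Lemma Zparam_bounds k i : (0 < k)%N -> 0 <= Zparam q k i <= q^-1 ^+ i.
Proof.
case: k => // k _; have /andP[ZY _] := @Zparam_sub_Yparam k.+1 i isT.
have /andP[Y0 _] := Yparam_bounds i.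
apply/andP; split; first by rewrite (le_trans Y0)// -subr_ge0.
rewrite /Zparam subSS subn0 addSn exprVn exprS exprD.
have b0 := qX_gt0 k; have b1 := qX_ge1 k.
have c0 := qX_gt0 i; have c1 := qX_ge1 i.
move: (q ^+ k) (q ^+ i) b0 b1 c0 c1 => b c b0 b1 c0 c1.
have D0 : 0 < q * (b * c) - 1.
  by rewrite subr_gt0 (lt_le_trans q1)// ler_peMr ?(ltW q0)// mulr_ege1.
(* With denominators cleared this is [(q - 1) * b * c <= q * b * c - 1], that is, [1 <= b * c]. *)
rewrite ler_pdivrMr// [leRHS]mulrC ler_pdivlMr// -mulrA mulrBl mul1r lerB//.
exact: mulr_ege1.
Qed.

Lemma sum_exprV_le n : \sum_(0 <= i < n) q^-1 ^+ i <= (1 - q^-1)^-1.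
Proof.
have := @geometric_le_lim R n 1 q^-1 ler01; rewrite invr_gt0 div1r.
rewrite (_ : series _ n = \sum_(0 <= i < n) q^-1 ^+ i); last first.
  by apply: eq_bigr => i _; rewrite /= mul1r.
by apply => //; rewrite gtr0_norm ?invr_gt0// invf_lt1.
Qed.

Lemma sum_Yparam_le n : \sum_(0 <= i < n) Yparam q i <= (1 - q^-1)^-1.
Proof.
apply: le_trans (sum_exprV_le n); apply: ler_sum => i _.
by have /andP[] := Yparam_bounds i.
Qed.

Lemma sum_Zparam_le k n : (0 < k)%N ->
  \sum_(0 <= i < n) Zparam q k i <= (1 - q^-1)^-1.
Proof.
move=> k0; apply: le_trans (sum_exprV_le n); apply: ler_sum => i _.
by have /andP[] := Zparam_bounds i k0.
Qed.

Let qVX_le1 i : q^-1 ^+ i <= 1.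
Proof. by rewrite exprVn invf_le1. Qed.

Lemma Yparam01 i : 0 <= Yparam q i <= 1.
Proof. by have /andP[-> /le_trans->] := Yparam_bounds i. Qed.

Lemma Zparam01 k i : (0 < k)%N -> 0 <= Zparam q k i <= 1.
Proof. by move=> k0; have /andP[-> /le_trans->] := Zparam_bounds i k0. Qed.

(** [M *+ 2] comes from [bern_mean_lipschitz], the other factor is the sum of the geometric series
    of ratio [q^-1]. *)
Definition mean_gap (M : R) : R := M *+ 2 * (1 - q^-1)^-1.

Lemma bern_mean_gap k n (f : nat -> R) (M : R) : (0 < k)%N ->
  (forall i, `|f i| <= M) ->
  `|bern_mean (Zparam q k) f n - bern_mean (Yparam q) f n| <=
    mean_gap M * q^-1 ^+ k.
Proof.
move=> k0 fM.
have M0 : 0 <= M by apply: le_trans (fM 0%N).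
apply: (le_trans (bern_mean_lipschitz _ _ _ fM)).
- by move=> i; exact: Zparam01.
- exact: Yparam01.
rewrite /mean_gap -mulrA ler_wpM2l ?mulrn_wge0//.
apply: (@le_trans _ _ (\sum_(0 <= i < n) q^-1 ^+ k * q^-1 ^+ i)).
  apply: ler_sum => i _; have /andP[ZY0 ZY] := Zparam_sub_Yparam i k0.
  by rewrite ger0_norm.
rewrite -mulr_sumr mulrC ler_wpM2r ?sum_exprV_le//.
by rewrite exprn_ge0// invr_ge0 ltW.
Qed.

Lemma cvg_mean_gap (M : R) (k_ : nat -> nat) : k_ n @[n --> \oo] --> \oo ->
  mean_gap M * q^-1 ^+ k_ n @[n --> \oo] --> 0.
Proof.
move=> koo; rewrite -[0](mulr0 (mean_gap M)); apply: cvgMr.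
apply: (@cvg_comp _ _ _ k_ (fun n => q^-1 ^+ n) _ _ _ koo).
by apply: cvg_expr; rewrite gtr0_norm ?invr_gt0// invf_lt1.
Qed.

(** The gap between the two means is uniform in the number of summands, so [n_] may vary in any way
    for which the means for [Yparam] converge. *)
Lemma cvg_bern_mean_Zparam (f : nat -> R) (M : R) (k_ n_ : nat -> nat) (l : R) :
  (forall i, `|f i| <= M) -> k_ n @[n --> \oo] --> \oo ->
  bern_mean (Yparam q) f (n_ n) @[n --> \oo] --> l ->
  bern_mean (Zparam q (k_ n)) f (n_ n) @[n --> \oo] --> l.
Proof.
move=> fM koo Yl; rewrite -[l]add0r.
rewrite (_ : (fun n => _) = (fun n => bern_mean (Zparam q (k_ n)) f (n_ n) -
   bern_mean (Yparam q) f (n_ n) + bern_mean (Yparam q) f (n_ n))); last first.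
  by apply/funext => n; rewrite subrK.
apply: cvgD => //; apply/norm_cvg0P.
apply: (squeeze_cvgr _ (@cvg_cst _ _ _ _ _)) (cvg_mean_gap M koo).
have /cvgnyPge/(_ 1%N) := koo; apply: filterS => n kn.
by rewrite normr_ge0 bern_mean_gap.
Qed.

(** The gap estimate survives the limit in [n] and bounds the distance from [lZ k] to [lY] by a
    multiple of [q^-1 ^+ k]. *)
Lemma cvg_lim_bern_mean_Zparam (f : nat -> R) (M : R) (lZ : nat -> R) (lY : R) :
  (forall i, `|f i| <= M) ->
  (forall k, (0 < k)%N ->
    bern_mean (Zparam q k) f n @[n --> \oo] --> lZ k) ->
  bern_mean (Yparam q) f n @[n --> \oo] --> lY ->
  lZ k @[k --> \oo] --> lY.
Proof.
move=> fM Zl Yl; apply/subr_cvg0; apply/norm_cvg0P.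
apply: (squeeze_cvgr _ (@cvg_cst _ _ _ _ _)) (cvg_mean_gap M cvg_id).
near=> k; have k0 : (0 < k)%N by near: k; exact: nbhs_infty_gt.
rewrite normr_ge0/=.
have ZYl : `|bern_mean (Zparam q k) f n - bern_mean (Yparam q) f n| @[n --> \oo]
    --> `|lZ k - lY|.
  by apply: cvg_norm; apply: cvgB Yl; exact: Zl.
rewrite -(cvg_lim _ ZYl)//; apply: limr_le; first by apply: cvgP ZYl.
by apply: nearW => n; exact: bern_mean_gap.
Unshelve. all: by end_near.
Qed.

End parameters.

(** * From Bernoulli means to convergence in distribution *)

Lemma bernoulli_true (R : realType) d (T : measurableType d)
    (P : probability T R) (X : {RV P >-> bool}) (p : R) : 0 <= p <= 1 ->
  distribution P X =1 bernoulli_prob p -> P (X @^-1` [set true]) = p%:E.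
Proof.
move=> p01 /(_ [set true]).
(* [bernoulli_prob] is defined by cases on [0 <= p <= 1], and [p01] selects the branch. *)
by rewrite /distribution/= /pushforward/= => ->; rewrite /bernoulli_prob p01 fsbig_set1.
Qed.

Lemma integral_bounded_fine (R : realType) (mu : probability R R) (f : R -> R) :
  continuous f -> bounded_fun f ->
  (\int[mu]_x (f x)%:E)%E = (fine (\int[mu]_x (f x)%:E))%:E.
Proof.
move=> cf /bounded_fun_le[M fM]; rewrite fineK//; apply: integrable_fin_num => //.
by apply: (bounded_integrable mu _ fM); exact: continuous_measurable_fun.
Qed.

Lemma integral_occurrences_law (R : realType) (q : {posnum R}) n k (f : R -> R) :
  1 < q%:num -> (0 < k)%N -> continuous f -> bounded_fun f ->
  (\int[occurrences_law n q k]_x (f x)%:E)%E =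
  (bern_mean (Zparam q%:num k) (fun i => f i%:R) (n - (k - 1)))%:E.
Proof.
move=> q1 k0 cf bf; apply: integral_nat_law => //; last exact: sum_coef_bern_prod.
by move=> i _; rewrite occurrences_law1// gt_eqF.
Qed.

Lemma EFin_cvgP (R : realType) (u : nat -> R) (l : R) :
  ((u n)%:E @[n --> \oo] --> l%:E) <-> (u n @[n --> \oo] --> l).
Proof.
split=> [/fine_cvg//|ul]; apply/fine_cvgP; split=> //.
exact: nearW.
Qed.

(** Common core of (ii) and (iii), where the number of summands [n - (k_ n - 1)] tends to infinity
    or becomes constant, respectively. *)
Lemma cvg_occurrences_law (R : realType) (q : {posnum R}) (k_ : nat -> nat)
    (f : R -> R) (l : R) :
  1 < q%:num -> continuous f -> bounded_fun f -> k_ n @[n --> \oo] --> \oo ->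
  bern_mean (Yparam q%:num) (fun i => f i%:R) (n - (k_ n - 1))%N
    @[n --> \oo] --> l ->
  (\int[occurrences_law n q (k_ n)]_x (f x)%:E)%E @[n --> \oo] --> l%:E.
Proof.
move=> q1 cf bf koo Yl; have [M fM] := bounded_fun_le bf.
have /EFin_cvgP := cvg_bern_mean_Zparam q1 (fun i => fM i%:R) koo Yl.
apply: cvg_trans; apply: near_eq_cvg.
have /cvgnyPge/(_ 1%N) := koo; apply: filterS => n kn.
by rewrite integral_occurrences_law.
Qed.

Theorem theorem8 (R : realType) (q : {posnum R})
    (dY : measure_display) (OmegaY : measurableType dY)
    (PY : probability OmegaY R) (Y : nat -> {RV PY >-> bool})
    (dZ : nat -> measure_display) (OmegaZ : forall k, measurableType (dZ k))
    (PZ : forall k, probability (OmegaZ k) R)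
    (Z : forall k, nat -> {RV (PZ k) >-> bool}) :
  1 < q%:num ->
  independent_RVs [set: nat] Y ->
  (forall i, distribution PY (Y i) =1
     bernoulli_prob ((q%:num - 1) / q%:num ^+ i.+1)) ->
  (forall k, (1 <= k)%N -> independent_RVs [set j | (k <= j)%N] (Z k)) ->
  (forall k j, (1 <= k <= j)%N -> distribution (PZ k) (Z k j) =1
     bernoulli_prob ((q%:num - 1) * q%:num ^+ (k - 1) / (q%:num ^+ j - 1))) ->
  [/\ (* (i) *)
      forall k, (1 <= k)%N ->
        cvg_in_distribution (fun n => occurrences_law n q k)
          (infinite_sum_law (Z k) k) /\
        PZ k [set x | exists m : nat, infinite_sum (Z k) k x = m%:R%:E] = 1%E,
      (* (ii) *)
      (forall k_ : nat -> nat,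
         (forall n, (1 <= n)%N -> (1 <= k_ n <= n)%N) ->
         k_ n @[n --> \oo] --> \oo ->
         (n - k_ n)%N @[n --> \oo] --> \oo ->
         cvg_in_distribution (fun n => occurrences_law n q (k_ n))
           (infinite_sum_law Y 0)) /\
      PY [set x | exists m : nat, infinite_sum Y 0 x = m%:R%:E] = 1%E,
      (* (iii) *)
      forall k,
        cvg_in_distribution (fun n => occurrences_law n q (n - k))
          (partial_sum_law Y 0 k.+1) /\
        PY [set x | exists m : nat,
              (m <= k.+1)%N /\ partial_sum Y 0 k.+1 x = m%:R] = 1%E,
      (* (iv) *)
      cvg_in_distribution (fun k => partial_sum_law Y 0 k.+1)
        (infinite_sum_law Y 0) /\
      cvg_in_distribution (fun k => infinite_sum_law (Z k) k)
        (infinite_sum_law Y 0) &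
      (exists mu : nat -> probability R R,
         (forall k, cvg_in_distribution
            (fun n => occurrences_law n q (n - k)) (mu k)) /\
         cvg_in_distribution mu (infinite_sum_law Y 0)) /\
      (exists nu : nat -> probability R R,
         (forall k, (1 <= k)%N -> cvg_in_distribution
            (fun n => occurrences_law n q k) (nu k)) /\
         cvg_in_distribution nu (infinite_sum_law Y 0))].
Proof.
move=> q1 indY lawY indZ lawZ.
have pY i : PY (Y (0 + i)%N @^-1` [set true]) = (Yparam q%:num i)%:E.
  by apply: bernoulli_true (lawY i); exact: Yparam01.
have indY0 : independent_RVs [set j | (0 <= j)%N] Y.
  by move=> J _; apply: indY => j.
have pZ k i : (0 < k)%N ->
    PZ k (Z k (k + i)%N @^-1` [set true]) = (Zparam q%:num k i)%:E.
  move=> k0; apply: bernoulli_true; first exact: Zparam01.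
  by apply: lawZ; rewrite k0 leq_addr.
have intY n f : continuous f -> bounded_fun f ->
    (\int[partial_sum_law Y 0 n]_x (f x)%:E)%E =
    (bern_mean (Yparam q%:num) (fun i => f i%:R) n)%:E.
  by move=> cf bf; rewrite -(integral_partial_sum_law indY0 pY).
have cvgY (f : R -> R) : continuous f -> bounded_fun f ->
    bern_mean (Yparam q%:num) (fun i => f i%:R) n @[n --> \oo] -->
    fine (\int[infinite_sum_law Y 0]_x (f x)%:E).
  move=> cf bf; apply/EFin_cvgP; rewrite -integral_bounded_fine//.
  exact: (cvg_bern_mean indY0 pY (sum_Yparam_le q1)).
have cvgZ k (f : R -> R) : (0 < k)%N -> continuous f -> bounded_fun f ->
    bern_mean (Zparam q%:num k) (fun i => f i%:R) n @[n --> \oo] -->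
    fine (\int[infinite_sum_law (Z k) k]_x (f x)%:E).
  move=> k0 cf bf; apply/EFin_cvgP; rewrite -integral_bounded_fine//.
  exact: (cvg_bern_mean (indZ k k0) (fun i => pZ k i k0)
    (fun n => sum_Zparam_le q1 n k0)).
have partI k : (0 < k)%N -> cvg_in_distribution
    (fun n => occurrences_law n q k) (infinite_sum_law (Z k) k).
  move=> k0 f cf bf; rewrite integral_bounded_fine//.
  rewrite (_ : (fun n => _) = fun n =>
    (bern_mean (Zparam q%:num k) (fun i => f i%:R) (n - (k - 1)))%:E); last first.
    by apply/funext => n; rewrite integral_occurrences_law.
  apply/EFin_cvgP; have := cvgZ k f k0 cf bf.
  (* Shifting the index by the fixed [k - 1] does not change the limit. *)
  by rewrite -(cvg_centern (k - 1)).
have partIII k : cvg_in_distribution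
    (fun n => occurrences_law n q (n - k)) (partial_sum_law Y 0 k.+1).
  move=> f cf bf; rewrite intY//; apply: cvg_occurrences_law => //.
    by apply/cvgnyPge => A; near=> n; rewrite leq_subRL; near: n; exact: nbhs_infty_ge.
  (* Once [k < n], the number of summands [n - (n - k - 1)] is exactly [k.+1]. *)
  apply: cvg_near_cst; near=> n; congr bern_mean.
  have kn : (k < n)%N by near: n; exact: nbhs_infty_gt.
  by rewrite -subnDA addn1 subKn.
have partIVY : cvg_in_distribution
    (fun k => partial_sum_law Y 0 k.+1) (infinite_sum_law Y 0).
  move=> f cf bf; rewrite integral_bounded_fine//.
  rewrite (_ : (fun n => _) = fun n =>
    (bern_mean (Yparam q%:num) (fun i => f i%:R) n.+1)%:E); last first.
    by apply/funext => n; rewrite intY.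
  by apply/EFin_cvgP; have := cvgY f cf bf; rewrite -cvg_shiftS.
have partIVZ : cvg_in_distribution
    (fun k => infinite_sum_law (Z k) k) (infinite_sum_law Y 0).
  move=> f cf bf; rewrite integral_bounded_fine//; have [M fM] := bounded_fun_le bf.
  rewrite (_ : (fun n => _) = fun k =>
    (fine (\int[infinite_sum_law (Z k) k]_x (f x)%:E))%:E); last first.
    by apply/funext => k; rewrite -integral_bounded_fine.
  apply/EFin_cvgP; apply: (@cvg_lim_bern_mean_Zparam _ _ q1 (fun i => f i%:R) M) => //.
    by move=> k k0; exact: cvgZ.
  exact: cvgY.
split.
- move=> k k0; split; first exact: partI.
  exact: (infinite_sum_nat (fun i => pZ k i k0)
    (fun n => sum_Zparam_le q1 n k0)).
- split; last exact: (infinite_sum_nat pY (sum_Yparam_le q1)).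
  move=> k_ kn koo nkoo f cf bf; rewrite integral_bounded_fine//.
  apply: cvg_occurrences_law => //.
  (* The number of summands is at least [n - k_ n], hence tends to infinity. *)
  apply: cvg_comp (cvgY f cf bf); apply/cvgnyPge => A.
  have /cvgnyPge/(_ A) := nkoo; apply: filterS => n An.
  by rewrite (leq_trans An)// leq_sub2l// leq_subr.
- move=> k; split; first exact: partIII.
  (* A finite sum of [k.+1] booleans lies in the required range everywhere, so the event is the
     whole space. *)
  rewrite (_ : [set x | _] = setT) ?probability_setT//.
  apply/seteqP; split=> // x _; exists (\sum_(0 <= i < k.+1) Y i x)%N; split.
    rewrite -[leqRHS]subn0 -[leqRHS]muln1 -sum_nat_const_nat.
    by apply: leq_sum => i _; case: (Y i x).
  by rewrite /partial_sum natr_sum.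
- by split.
(* The inner limits are the laws found in (iii) and (i); (iv) gives the outer ones. *)
- split; first by exists (fun k => partial_sum_law Y 0 k.+1).
  by exists (fun k => infinite_sum_law (Z k) k).
Unshelve. all: by end_near.
Qed.
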